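(* For any finite sequence $\{X_k\}$ of independent random matrices with values in $\mathcal{S}_d$ and any $t \in \mathbb{R}$, $$\mathbb{P}\left\{\lambda_{\min }\left(\sum_k X_k\right) \geq t\right\} \leq \frac{1}{d} \inf _{\theta>0}\left\{e^{-\theta t} \cdot \operatorname{tr} \exp \left(\sum_k \log \mathbb{E}\, e^{\theta X_k}\right)\right\}.$$
   Context: $\mathcal{S}_d$ denotes the set of $d\times d$ real symmetric matrices. $\lambda_{\min}$ denotes the smallest eigenvalue. The exponential of a symmetric matrix and the logarithm of a positive definite matrix are obtained by applying the scalar function to the eigenvalues in an orthogonal diagonalization. Expectations are entrywise; the expression in the infimum is regarded as $+\infty$ for those $\theta$ at which some $\mathbb{E}\,e^{\theta X_k}$ is not finite. *)

(* Defs.v *)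
From HB Require Import structures.
From mathcomp Require Import all_boot all_order all_algebra.
From mathcomp Require Import all_classical all_reals all_analysis.

Set Implicit Arguments.
Unset Strict Implicit.
Unset Printing Implicit Defensive.

Import Order.TTheory GRing.Theory Num.Theory.
Import numFieldNormedType.Exports.

Local Open Scope classical_set_scope.
Local Open Scope ring_scope.

(* For a symmetric A with d > 0 the set of eigenvalues is finite and nonempty,
   so that the infimum is a minimum. *)
Definition lambda_min (R : realType) (d : nat) (A : 'M[R]_d) : R :=
  inf [set a : R | eigenvalue A a].

Definition orth_diag (R : realType) (d : nat)
    (A Q : 'M[R]_d) (v : 'rV[R]_d) : Prop :=
  Q *m Q^T = 1%:M /\ A = Q *m diag_mx v *m Q^T.

(* The result does not depend on the diagonalization chosen (see mxfunE).
   The value is the junk value 0 if A is not orthogonally diagonalizable, that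
   is, if A is not symmetric. *)
Definition mxfun (R : realType) (d : nat) (f : R -> R) (A : 'M[R]_d) : 'M[R]_d :=
  xget 0 [set B | exists Q : 'M[R]_d, exists v : 'rV[R]_d,
    orth_diag A Q v /\ B = Q *m diag_mx (map_mx f v) *m Q^T].

Lemma mxfunE (R : realType) (d : nat) (f : R -> R) (A Q : 'M[R]_d)
    (v : 'rV[R]_d) : orth_diag A Q v ->
  mxfun f A = Q *m diag_mx (map_mx f v) *m Q^T.
Proof.
move=> [QQ AE]; rewrite /mxfun; case: xgetP => [B _ | noB]; last first.
  by case: (noB (Q *m diag_mx (map_mx f v) *m Q^T)); exists Q, v.
move=> [Q' [v' [[QQ' AE'] ->]]].
have TQ : Q^T *m Q = 1%:M by apply: mulmx1C.
have TQ' : Q'^T *m Q' = 1%:M by apply: mulmx1C.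
pose U := Q'^T *m Q.
have UE : U *m diag_mx v = diag_mx v' *m U.
  have : Q'^T *m A *m Q = Q'^T *m A *m Q by [].
  rewrite {1}AE AE' !mulmxA TQ' mul1mx -!mulmxA TQ mulmx1.
  by rewrite /U !mulmxA.
have fUE : U *m diag_mx (map_mx f v) = diag_mx (map_mx f v') *m U.
  apply/matrixP=> i j; move/matrixP/(_ i j): UE.
  rewrite !mul_mx_diag !mul_diag_mx !mxE mulrC => /eqP.
  rewrite -subr_eq0 -mulrBl mulf_eq0 subr_eq0 => /orP[/eqP ->|/eqP ->].
    by rewrite mulrC.
  by rewrite mul0r mulr0.
have QU : Q' *m U = Q by rewrite mulmxA QQ' mul1mx.
have UQ : U *m Q^T = Q'^T by rewrite -mulmxA QQ mulmx1.
clear UE; clearbody U.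
rewrite -UQ -!mulmxA (mulmxA (diag_mx _) U) -fUE.
by rewrite -{2}QU !mulmxA.
Qed.

Definition mxexp (R : realType) (d : nat) (A : 'M[R]_d) : 'M[R]_d :=
  mxfun expR A.

Definition mxlog (R : realType) (d : nat) (A : 'M[R]_d) : 'M[R]_d :=
  mxfun (@ln R) A.

Definition borel_mx (R : realType) (d : nat) :=
  g_sigma_algebraType (@open 'M[R]_d).

Definition random_symmx (disp : measure_display) (T : measurableType disp)
    (R : realType) (d : nat) (X : T -> 'M[R]_d) : Prop :=
  measurable_fun setT (X : T -> borel_mx R d) /\ forall w, (X w)^T = X w.

(* Since I is finite and B i may be the whole space, the product rule for the
   full family gives the product rule for every subfamily. *)
Definition independent_mx (disp : measure_display) (T : measurableType disp)
    (R : realType) (P : probability T R) (I : finType) (d : nat)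
    (X : I -> T -> 'M[R]_d) : Prop :=
  forall B : I -> set (borel_mx R d), (forall i, measurable (B i)) ->
    (P (\bigcap_i (X i @^-1` B i)) = \prod_(i : I) P (X i @^-1` B i))%E.

Definition integrable_mx (disp : measure_display) (T : measurableType disp)
    (R : realType) (P : probability T R) (d : nat) (M : T -> 'M[R]_d) : Prop :=
  forall i j, P.-integrable setT (EFin \o (fun w => M w i j)).

Definition expectation_mx (disp : measure_display) (T : measurableType disp)
    (R : realType) (P : probability T R) (d : nat) (M : T -> 'M[R]_d) :
    'M[R]_d :=
  \matrix_(i, j) fine ('E_P[(fun w => M w i j)])%E.

Definition trace_bound (disp : measure_display) (T : measurableType disp)
    (R : realType) (P : probability T R) (I : finType) (d : nat)
    (X : I -> T -> 'M[R]_d) (t theta : R) : \bar R :=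
  if `[< forall k, integrable_mx P (fun w => mxexp (theta *: X k w)) >] then
    (expR (- (theta * t)) *
      \tr (mxexp (\sum_k
        mxlog (expectation_mx P (fun w => mxexp (theta *: X k w))))))%:E
  else +oo%E.

(* Main.v *)
(** Pointwise, [d e^(theta lambda_min Y) <= tr exp(theta Y)], so the claim
    reduces to [E tr exp(sum theta X_k) <= tr exp(sum log E e^(theta X_k))].
    The [X_k] are replaced one at a time: by independence the other summands
    may be frozen to a constant [H], and one needs Jensen's inequality for
    the map [A |-> tr exp(H + log A)], which is concave by Lieb's theorem.

    Concavity enters only through the tangent at [A0 = E e^(theta X_k)]:
    with [T0 = exp(H + log A0)] and [L] the derivative of [log] at [A0] in
    the direction [T0], one has [tr exp(H + log A) <= tr (L A)], with
    equality at [A0]. For [T = exp(H + log A)] this is the tangent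
    inequality at [(T0, A0)] of the jointly convex relative entropy [tr (T
    (log T - log A))]. The latter equals [int_0^1 (<T, M_x^-1 T> - tr T) /
    (1 - x) dx] with [M_x Y = (1 - x) Y A + x T Y], and [(T, M) |-> <T, M^-1
    T>] lies above its tangents by completing a square. In eigenbases the
    integrals become explicit divided differences of [ln x] and [x ln x]. *)

Require Import Defs.
From HB Require Import structures.
From mathcomp Require Import all_boot all_order all_algebra.
From mathcomp Require Import complex ring lra.
From mathcomp Require Import all_classical all_reals all_analysis.
From mathcomp Require Import measurable_realfun.

Set Implicit Arguments.
Unset Strict Implicit.
Unset Printing Implicit Defensive.

Import Order.TTheory GRing.Theory Num.Theory.
Import numFieldNormedType.Exports.

Local Open Scope classical_set_scope.
Local Open Scope ring_scope.

(** * Real symmetric matrices are orthogonally diagonalizable *)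

(** A complex eigenvalue [z] exists because [R[i]] is algebraically closed. For an eigenvector [x],
    evaluating [x A x^*] in two ways shows that [z] equals its conjugate. So [z] is a real root of
    the characteristic polynomial and has a real eigenvector, which is then normalized. *)
Lemma sym_eigenvector (R : rcfType) (n : nat) (A : 'M[R]_n.+1) : A^T = A ->
  exists a, exists2 u : 'rV[R]_n.+1, u *m A = a *: u & u *m u^T = 1%:M.
Proof.
move=> symA.
have [a /eigenvalueP[u uA u0]] : exists a, eigenvalue A a.
  pose i : {rmorphism R -> R[i]%C} := real_complex R.
  have [//|z zA] := @eigenvalue_closed R[i]%C _ (map_mx i A).
  have zreal : z \is Num.real.
    have /eigenvalueP[x xA x0] := zA.
    pose y := map_mx Num.conj_op x.
    pose s := (x *m y^T) 0 0.
    have s0 : s > 0.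
      rewrite /s mxE; under eq_bigr do rewrite !mxE.
      rewrite lt_def sumr_ge0 ?andbT; last by move=> j _; exact: mul_conjC_ge0.
      apply: contraNneq x0 => s0; apply/eqP/rowP => j; rewrite mxE.
      move/eqP: s0; rewrite psumr_eq0; last by move=> k _; exact: mul_conjC_ge0.
      by move/allP/(_ j (mem_index_enum _)); rewrite /= mul_conjC_eq0 => /eqP.
    have yA : y *m map_mx i A = Num.conj_op z *: y.
      have := congr1 (map_mx (@Num.conj_op R[i]%C)) xA.
      rewrite map_mxM map_mxZ -/y => <-; congr (_ *m _).
      apply/matrixP => j k; rewrite !mxE /= conj_Creal//.
      by apply/complex_realP; eexists.
    have : x *m map_mx i A *m y^T = z *: (x *m y^T) by rewrite xA scalemxAl.
    rewrite -mulmxA -[map_mx i A *m _]trmxK trmx_mul trmxK.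
    rewrite [(map_mx i A)^T]matrix.map_trmx symA yA.
    rewrite linearZ /= -scalemxAr => /matrixP/(_ 0 0); rewrite !mxE -/s.
    have -> : \sum_j x 0 j * y^T j 0 = s by rewrite /s mxE.
    by rewrite CrealE; move/(mulIf (lt0r_neq0 s0)) ->.
  move: zreal zA => /complex_realP[a ->]; rewrite eigenvalue_root_char => zA.
  exists a.
  by move: zA; rewrite eigenvalue_root_char -map_char_poly (fmorph_root i).
have u2 : 0 < (u *m u^T) 0 0.
  rewrite mxE; under eq_bigr do rewrite mxE -expr2.
  rewrite lt_def sumr_ge0 ?andbT; last by move=> j _; exact: sqr_ge0.
  apply: contraNneq u0 => /eqP; rewrite psumr_eq0; last first.
    by move=> k _; exact: sqr_ge0.
  move=> /allP u0; apply/eqP/rowP => j; rewrite mxE.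
  by have := u0 j (mem_index_enum _); rewrite /= sqrf_eq0 => /eqP.
set s := (u *m u^T) 0 0 in u2.
exists a, ((Num.sqrt s)^-1 *: u).
  by rewrite -scalemxAl uA !scalerA mulrC.
rewrite linearZ /= -scalemxAl -scalemxAr scalerA -expr2 exprVn sqr_sqrtr ?ltW//.
by rewrite [u *m u^T]mx11_scalar -/s scale_scalar_mx mulVf// gt_eqF.
Qed.

(** For [u] different from the first basis vector [e], take the reflection in the hyperplane
    orthogonal to [w = e - u], which exchanges [e] and [u]. *)
Lemma householder (R : realFieldType) (n : nat) (u : 'rV[R]_n.+1) :
  u *m u^T = 1%:M ->
  exists Q : 'M[R]_n.+1, [/\ Q^T = Q, Q *m Q = 1%:M & delta_mx 0 0 *m Q = u].
Proof.
move=> uu; pose e : 'rV[R]_n.+1 := delta_mx 0 0.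
have [<-|ue] := eqVneq e u.
  by exists 1%:M; rewrite trmx1 !mulmx1.
pose w := e - u.
have ee : e *m e^T = 1%:M.
  rewrite /e trmx_delta mul_delta_mx_cond.
  by apply/matrixP => i j; rewrite !ord1 !mxE.
pose c := (e *m u^T) 0 0.
have eu : e *m u^T = c%:M by rewrite [LHS]mx11_scalar.
have ueT : u *m e^T = c%:M.
  by rewrite -[LHS]trmxK trmx_mul trmxK eu tr_scalar_mx.
have ew : e *m w^T = (1 - c)%:M by rewrite /w linearB /= mulmxBr ee eu raddfB.
have ww : w *m w^T = (2 * (1 - c))%:M.
  rewrite {1}/w mulmxBl ew {1}/w linearB /= mulmxBr ueT uu -!raddfB /=.
  by congr _%:M; ring.
have c1 : 1 - c != 0.
  apply: contraNneq ue => c1; move: ww; rewrite c1 mulr0 -subr_eq0 -/w.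
  clearbody w => /matrixP/(_ 0 0); rewrite !mxE eqxx mulr1n => /eqP.
  rewrite psumr_eq0; last by move=> k _; rewrite mxE -expr2 sqr_ge0.
  move=> /allP w0; apply/eqP/rowP => j; rewrite [RHS]mxE.
  by have := w0 j (mem_index_enum _); rewrite /= mxE -expr2 sqrf_eq0 => /eqP.
(* As [w w^T = 2 (1 - c)], the factor [2 / |w|^2] of the reflection is [1 / (1 - c)]. *)
exists (1%:M - (1 - c)^-1 *: (w^T *m w)); split.
- by rewrite linearB /= linearZ /= trmx_mul trmxK trmx1.
- clearbody w; rewrite mulmxBl mul1mx mulmxBr mulmx1 -scalemxAl -scalemxAr.
  rewrite mulmxA -(mulmxA w^T) ww mul_mx_scalar -scalemxAl !scalerA.
  rewrite -addrA -[RHS]addr0; congr (_ + _).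
  rewrite -scalerBl -opprD -scalerDl; apply/eqP; rewrite oppr_eq0 scaler_eq0.
  by apply/orP; left; apply/eqP; field.
rewrite mulmxBr mulmx1 -scalemxAr [e *m _]mulmxA ew mul_scalar_mx scalerA.
by rewrite mulVf// scale1r opprB addrC subrK.
Qed.

(** Induction on the dimension. Conjugation by the reflection of a unit eigenvector leaves only the
    corner [a] in the first row, by symmetry also in the first column, and the remaining block is
    diagonalized by induction. *)
Lemma sym_orth_diag (R : realType) (n : nat) (A : 'M[R]_n) : A^T = A ->
  exists Q v, orth_diag A Q v.
Proof.
elim: n A => [|n IH] A symA.
  by exists 1%:M, 0; split; apply/matrixP => -[].
have [a [u uA uu]] := sym_eigenvector symA.
have [Q [QT QQ eQ]] := householder uu.
pose B : 'M[R]_(1 + n) := Q *m A *m Q.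
have symB : B^T = B by rewrite /B !trmx_mul symA QT mulmxA.
have eB : row 0 B = a *: delta_mx 0 0.
  by rewrite rowE /B !mulmxA eQ uA -scalemxAl -eQ -mulmxA QQ mulmx1.
have AB : A = Q *m B *m Q by rewrite /B !mulmxA QQ mul1mx -mulmxA QQ mulmx1.
clearbody B.
have [Q' [v [QQ' BE]]] : exists Q v, orth_diag (drsubmx B) Q v.
  by apply: IH; rewrite trmx_drsub symB.
have Bur : ursubmx B = 0.
  apply/matrixP => i j; rewrite !mxE ord1.
  have := congr1 (fun m : 'rV[R]_(1 + n) => m 0 (rshift 1 j)) eB.
  rewrite !mxE. rewrite mulr0 => <-; congr (B _ _); exact/val_inj.
have Bul : ulsubmx B = a%:M.
  apply/matrixP => i j; rewrite !mxE !ord1.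
  have := congr1 (fun m : 'rV[R]_(1 + n) => m 0 0) eB.
  rewrite !mxE !eqxx mulr1 mulr1n => <-; congr (B _ _); exact/val_inj.
have Bdl : dlsubmx B = 0 by rewrite -[LHS]trmxK trmx_dlsub symB Bur trmx0.
pose S : 'M[R]_(1 + n) := block_mx 1%:M 0 0 Q'.
have SS : S *m S^T = 1%:M.
  rewrite /S tr_block_mx mulmx_block.
  rewrite !trmx0 trmx1 !(mulmx0,mul0mx,addr0,add0r,mulmx1) QQ'.
  by rewrite -scalar_mx_block.
have SBS : B = S *m diag_mx (row_mx a%:M v) *m S^T.
  rewrite -[LHS]submxK Bur Bul Bdl BE diag_mx_row /S tr_block_mx !mulmx_block.
  rewrite !trmx0 trmx1 !(mulmx0,mul0mx,addr0,add0r,mulmx1,mul1mx).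
  by congr block_mx; apply/matrixP => i j; rewrite !mxE !ord1.
exists (Q *m S), (row_mx a%:M v : 'rV_(1 + n)); split.
  by rewrite trmx_mul !mulmxA -(mulmxA Q) SS mulmx1 QT QQ.
by rewrite AB SBS trmx_mul QT !mulmxA.
Qed.

(** * The joint convexity of relative entropy *)

(** The integral is witnessed by an antiderivative, since every integrand below has an explicit one;
    linearity is then that of the derivative. *)
Definition has_integral01 (R : realType) (f : R -> R) (v : R) : Prop :=
  exists F : R -> R,
    (forall x : R, 0 <= x <= 1 -> is_derive x (1 : R) F (f x)) /\ F 1 - F 0 = v.

Section has_integral01_theory.
Variable R : realType.
Implicit Types (f g : R -> R) (u v a b p q t x : R).

Lemma has_integral01_ext f g v : (forall x, 0 <= x <= 1 -> f x = g x) ->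
  has_integral01 f v -> has_integral01 g v.
Proof.
by move=> fg [F [dF <-]]; exists F; split=> // x x01; rewrite -fg//; exact: dF.
Qed.

Lemma has_integral01D f g u v : has_integral01 f u -> has_integral01 g v ->
  has_integral01 (fun x => f x + g x) (u + v).
Proof.
move=> [F [dF <-]] [G [dG <-]]; exists (F + G); split=> [x x01|].
  by apply: is_deriveD; [exact: dF|exact: dG].
rewrite -[(F + G) 1]/(F 1 + G 1) -[(F + G) 0]/(F 0 + G 0).
by rewrite opprD addrACA.
Qed.

Lemma has_integral01Z k f v : has_integral01 f v ->
  has_integral01 (fun x => k * f x) (k * v).
Proof.
move=> [F [dF <-]]; exists (k \*: F); split=> [x x01|].
  by apply: is_deriveZ; exact: dF.
by rewrite -[(k \*: F) 1]/(k * F 1) -[(k \*: F) 0]/(k * F 0) mulrBr.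
Qed.

Lemma has_integral01_sum (I : finType) (f : I -> R -> R) (v : I -> R) :
  (forall i, has_integral01 (f i) (v i)) ->
  has_integral01 (fun x => \sum_i f i x) (\sum_i v i).
Proof.
move=> fv; elim: (index_enum I) => [|i s IH].
  exists (cst 0); split=> [x x01|]; rewrite big_nil; first exact: is_derive_cst.
  by rewrite subrr.
rewrite big_cons; apply: has_integral01_ext (has_integral01D (fv i) IH) => x _.
by rewrite big_cons.
Qed.

(** By the mean value theorem [v] is a value of [f] at an interior point. *)
Lemma has_integral01_ge0 f v : has_integral01 f v ->
  (forall x, 0 < x < 1 -> 0 <= f x) -> 0 <= v.
Proof.
move=> [F [dF <-]] f0.
have [||c c01 ->] := @MVT R F f 0 1 ltr01.
- by move=> x; rewrite in_itv /= => /andP[x0 x1]; apply: dF; rewrite !ltW.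
- have dF' x : x \in `[0, 1]%R -> derivable F x 1.
    by rewrite in_itv /= => x01; have := dF x x01; case.
  exact: (derivable_within_continuous dF').
by rewrite subr0 mulr1; apply: f0; move: c01; rewrite in_itv.
Qed.

(** The eigenvalue of [M_x] at [u v^T], where [u] is an eigenvector of [T] for [p] and [v] one of
    [A] for [a]. *)
Definition mix (a p x : R) : R := (1 - x) * a + x * p.

Lemma mix_gt0 a p x : 0 < a -> 0 < p -> 0 <= x <= 1 -> 0 < mix a p x.
Proof.
move=> a0 p0 /andP[x0 x1]; rewrite /mix.
have [->|xn1] := eqVneq x 1; first by rewrite subrr mul0r add0r mul1r.
have x1' : 0 < 1 - x by rewrite subr_gt0 lt_neqAle xn1.
by rewrite ltr_pwDl// ?mulr_gt0// mulr_ge0// ltW.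
Qed.

Lemma is_derive_mix a p x : is_derive x 1 (mix a p) (p - a).
Proof.
have -> : mix a p = cst a + (p - a) \*: id.
  by apply/funext => y; rewrite /mix -[RHS]/(a + (p - a) * y); ring.
by apply: is_derive_eq; rewrite add0r -[LHS]/((p - a) * 1) mulr1.
Qed.

Lemma is_derive_ln_mix a p x : 0 < a -> 0 < p -> 0 <= x <= 1 ->
  is_derive x 1 (fun y => ln (mix a p y)) ((p - a) / mix a p x).
Proof.
move=> a0 p0 x01; have D := is_derive_mix a p x.
have L := is_derive1_ln (mix_gt0 a0 p0 x01).
by apply: (is_derive_eq (is_derive1_comp L D)); rewrite mulrC.
Qed.

Lemma mix0 a p : mix a p 0 = a. Proof. by rewrite /mix; ring. Qed.
Lemma mix1 a p : mix a p 1 = p. Proof. by rewrite /mix; ring. Qed.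

Lemma is_derive_id_mix a p x : 0 < a -> 0 < p -> 0 <= x <= 1 ->
  is_derive x 1 (fun y => y / mix a p y) (a / mix a p x ^+ 2).
Proof.
move=> a0 p0 x01; have D := is_derive_mix a p x.
have m0 : mix a p x != 0 by rewrite gt_eqF// mix_gt0.
have V := is_deriveV m0 D.
apply: (is_derive_eq (is_deriveM (is_derive_id x 1) V)).
rewrite /GRing.scale /=.
move: m0; rewrite /mix => m0; field; exact: m0.
Qed.

(** With [m = mix a t x] one has [t - m = (1 - x) (t - a)], so the integrand is
    [(t^2 / m - t) / (1 - x)] with its singularity at 1 cancelled. *)
Lemma has_integral01_ln a t : 0 < a -> 0 < t ->
  has_integral01 (fun x => t * (t - a) / mix a t x) (t * (ln t - ln a)).
Proof.
move=> a0 t0; apply: (@has_integral01_ext (fun x => t * ((t - a) / mix a t x))).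
  by move=> x _; rewrite mulrA.
apply: has_integral01Z; exists (fun y => ln (mix a t y)).
by split; [move=> x; exact: is_derive_ln_mix|rewrite mix0 mix1].
Qed.

(** The first divided difference of [x ln x]. *)
Definition xln_ddiff (p q : R) : R :=
  if p == q then ln p + 1 else (p * ln p - q * ln q) / (p - q).

(** Writing [m_p] and [m_q] for the two mixes, [1 - x] times the integrand is [p / m_p + q / m_q - x
    p q / (m_p m_q) - 1], which is how [T] enters the tangent. *)
Lemma has_integral01_xln_ddiff a p q : 0 < a -> 0 < p -> 0 < q ->
  has_integral01
    (fun x => (p * q - (1 - x) * (p - a) * (q - a)) / (mix a p x * mix a q x))
    (xln_ddiff p q - ln a).
Proof.
move=> a0 p0 q0; rewrite /xln_ddiff; have [->|pq] := eqVneq p q.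
  exists (fun y => ln (mix a q y) + q * (y / mix a q y)); split.
    move=> x x01.
    have := is_deriveD (is_derive_ln_mix a0 q0 x01)
      (is_deriveZ q (is_derive_id_mix a0 q0 x01)).
    move=> /is_derive_eq; apply; rewrite /GRing.scale /=.
    have := mix_gt0 a0 q0 x01; rewrite /mix => /lt0r_neq0 m0; field; exact: m0.
  by rewrite !mix0 !mix1 mul0r mulr0 addr0 mul1r mulfV ?gt_eqF//; ring.
have pq0 : p - q != 0 by rewrite subr_eq0.
exists (fun y => (p - q)^-1 * (p * ln (mix a p y) + (- q) * ln (mix a q y))).
split=> [x x01|]; last by rewrite !mix0 !mix1; field.
have := is_deriveZ (p - q)^-1 (is_deriveD
  (is_deriveZ p (is_derive_ln_mix a0 p0 x01))
  (is_deriveZ (- q) (is_derive_ln_mix a0 q0 x01))).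
move=> /is_derive_eq; apply; rewrite /GRing.scale /=.
have := mix_gt0 a0 q0 x01; have := mix_gt0 a0 p0 x01.
by rewrite /mix => /lt0r_neq0 m0 /lt0r_neq0 m1; field; rewrite pq0 m0 m1.
Qed.

(** The first divided difference of [ln]; it gives the derivative of the matrix logarithm in an
    eigenbasis. *)
Definition ln_ddiff (a b : R) : R :=
  if a == b then a^-1 else (ln a - ln b) / (a - b).

(** The substitution [s = x p / (1 - x)] turns this into [p] times the usual integral of
    [1 / ((a + s) (b + s))] over [s > 0]. *)
Lemma has_integral01_ln_ddiff a b p : 0 < a -> 0 < b -> 0 < p ->
  has_integral01 (fun x => p ^+ 2 / (mix a p x * mix b p x)) (p * ln_ddiff a b).
Proof.
move=> a0 b0 p0; rewrite /ln_ddiff; have [->|ab] := eqVneq a b.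
  exists (fun y => p ^+ 2 / b * (y / mix b p y)); split.
    move=> x x01.
    have := is_deriveZ (p ^+ 2 / b) (is_derive_id_mix b0 p0 x01).
    move=> /is_derive_eq; apply; rewrite /GRing.scale /=.
    have := mix_gt0 b0 p0 x01; rewrite /mix => /lt0r_neq0 m0; field.
    by rewrite m0 gt_eqF.
  by rewrite mix0 mix1; field; rewrite !gt_eqF.
have ab0 : a - b != 0 by rewrite subr_eq0.
exists (fun y => - p / (a - b) * (ln (mix a p y) + -1 * ln (mix b p y))).
split=> [x x01|]; last by rewrite !mix0 !mix1; field.
have := is_deriveZ (- p / (a - b)) (is_deriveD (is_derive_ln_mix a0 p0 x01)
  (is_deriveZ (- 1) (is_derive_ln_mix b0 p0 x01))).
move=> /is_derive_eq; apply; rewrite /GRing.scale /=.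
have := mix_gt0 b0 p0 x01; have := mix_gt0 a0 p0 x01.
by rewrite /mix => /lt0r_neq0 m0 /lt0r_neq0 m1; field; rewrite ab0 m0 m1.
Qed.

End has_integral01_theory.

(** * Traces in terms of entries and eigenbases *)

Section traces.
Variables (R : comNzRingType) (d : nat).
Implicit Types (M Y Z Q U V : 'M[R]_d) (s t : 'rV[R]_d).

Lemma mxtrace_trmx_mul3 Y M Z :
  \tr (Y^T *m M *m Z) = \sum_i \sum_l \sum_j M i l * (Y i j * Z l j).
Proof.
rewrite /mxtrace; under eq_bigr do rewrite mxE.
under eq_bigr do under eq_bigr do rewrite mxE mulr_suml.
under eq_bigr do rewrite exchange_big.
rewrite exchange_big; apply: eq_bigr => i _; rewrite exchange_big.
apply: eq_bigr => l _; apply: eq_bigr => j _; rewrite !mxE; ring.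
Qed.

Lemma mxtrace_conj Q M : Q *m Q^T = 1%:M -> \tr (Q *m M *m Q^T) = \tr M.
Proof. by move=> QQ; rewrite mxtrace_mulC mulmxA (mulmx1C QQ) mul1mx. Qed.

Lemma mxtrace_conjT Q M : Q *m Q^T = 1%:M -> \tr (Q^T *m M *m Q) = \tr M.
Proof. by move=> QQ; rewrite mxtrace_mulC mulmxA QQ mul1mx. Qed.

Lemma mxtrace_diag_mul3 t Y Z :
  \tr (Y^T *m diag_mx t *m Z) = \sum_i \sum_j t 0 i * (Y i j * Z i j).
Proof.
rewrite mxtrace_trmx_mul3; apply: eq_bigr => i _.
rewrite exchange_big; apply: eq_bigr => j _.
rewrite (bigD1 i)//= big1 ?addr0; first by rewrite mxE eqxx.
by move=> l li; rewrite mxE eq_sym (negPf li) mul0r.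
Qed.

(** Traces involving two matrices that need not commute become sums over pairs of eigenvalues,
    weighted by the squared inner products of their eigenvectors. *)
Lemma mxtrace_orth_diag2 U V s t :
  \tr ((U *m diag_mx t *m U^T) *m (V *m diag_mx s *m V^T)) =
  \sum_i \sum_j (U^T *m V) i j ^+ 2 * (t 0 i * s 0 j).
Proof.
have -> : \tr ((U *m diag_mx t *m U^T) *m (V *m diag_mx s *m V^T)) =
  \tr ((U^T *m V)^T *m diag_mx t *m (U^T *m V *m diag_mx s)).
  by rewrite trmx_mul trmxK !mulmxA mxtrace_mulC !mulmxA.
rewrite mxtrace_diag_mul3; apply: eq_bigr => i _; apply: eq_bigr => j _.
by rewrite [in LHS]mul_mx_diag; move: (U^T *m V) => W; rewrite mxE; ring.
Qed.

End traces.

Section relative_entropy.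
Variables (R : realType) (d : nat).
Variables (U V U0 V0 : 'M[R]_d) (t a tau al : 'rV[R]_d).
Hypotheses (UU : U *m U^T = 1%:M) (VV : V *m V^T = 1%:M).
Hypotheses (UU0 : U0 *m U0^T = 1%:M) (VV0 : V0 *m V0^T = 1%:M).
Hypotheses (t0 : forall i, 0 < t 0 i) (a0 : forall i, 0 < a 0 i).
Hypotheses (tau0 : forall i, 0 < tau 0 i) (al0 : forall i, 0 < al 0 i).

Let T := U *m diag_mx t *m U^T.
Let A := V *m diag_mx a *m V^T.
(** [C] compares the eigenbases of [T] and [A], and [c] those of [T0] and [A0]; [B] and [A'] are [T]
    and [A] written in the eigenbases of [T0] and [A0]. *)
Let C := U^T *m V.
Let c := U0^T *m V0.
Let B := U0^T *m T *m U0.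
Let A' := V0^T *m A *m V0.

Let B_sym i l : B i l = B l i.
Proof.
suff : B^T = B by move=> BT; rewrite -{1}BT mxE.
by rewrite /B /T !trmx_mul !trmxK tr_diag_mx !mulmxA.
Qed.

(* Completing a square: [<T, M^-1 T> >= 2 <T, Y> - <Y, M Y>] for the positive
   operator [M Y = (1 - x) Y A + x T Y] and [Y = U0 y V0^T]. *)
Let quadratic_bound (y : 'M[R]_d) (x : R) : 0 <= x <= 1 ->
  \sum_i \sum_l \sum_j B i l *
    (y i j * c l j + c i j * y l j - x * (y i j * y l j))
  - (1 - x) * (\sum_i \sum_j \sum_k A' j k * (y i j * y i k))
  <= \sum_i \sum_j C i j ^+ 2 * (t 0 i ^+ 2 / mix (a 0 j) (t 0 i) x).
Proof.
move=> x01.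
(* The matrix [U0 y V0^T] in the eigenbases of [T] and [A], where [M_x] acts entrywise as
   multiplication by [mix]. *)
pose y' := U^T *m U0 *m y *m V0^T *m V.
have E1 : \sum_i \sum_j t 0 i * (y' i j * C i j) = \tr (y^T *m B *m c).
  rewrite -mxtrace_diag_mul3 /y' /C /B /c !trmx_mul !trmxK.
  rewrite !mulmxA -(mulmxA _ U0 U0^T) UU0 mulmx1.
  rewrite -[LHS](mxtrace_conj _ VV) !mulmxA VV mul1mx -(mulmxA _ V V^T) VV.
  rewrite mulmx1.
  by rewrite -!mulmxA mxtrace_mulC !mulmxA.
have E2 : \sum_i \sum_j a 0 j * y' i j ^+ 2 =
    \sum_i \sum_j \sum_k A' j k * (y i j * y i k).
  transitivity (\tr (y'^T^T *m diag_mx a *m y'^T)).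
    rewrite mxtrace_diag_mul3 exchange_big; apply: eq_bigr => j _.
    by apply: eq_bigr => i _; rewrite !mxE expr2.
  transitivity (\tr (y^T^T *m A' *m y^T)).
    rewrite /y' /A' /A !trmx_mul !trmxK !mulmxA -[RHS](mxtrace_conj _ UU0).
    by rewrite -[RHS](mxtrace_conjT _ UU) !mulmxA.
  rewrite mxtrace_trmx_mul3; under eq_bigr do rewrite exchange_big.
  rewrite exchange_big; apply: eq_bigr => i _; apply: eq_bigr => j _.
  by apply: eq_bigr => k _; rewrite !mxE.
have E3 : \sum_i \sum_j t 0 i * y' i j ^+ 2 = \tr (y^T *m B *m y).
  transitivity (\tr (y'^T *m diag_mx t *m y')).
    rewrite mxtrace_diag_mul3; apply: eq_bigr => i _; apply: eq_bigr => j _.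
    by rewrite expr2.
  rewrite /y' /B /T !trmx_mul !trmxK !mulmxA -[LHS](mxtrace_conj _ VV).
  rewrite -[RHS](mxtrace_conj _ VV0) !mulmxA VV mul1mx.
  by rewrite -(mulmxA _ V V^T) VV mulmx1.
have -> : \sum_i \sum_l \sum_j B i l *
      (y i j * c l j + c i j * y l j - x * (y i j * y l j)) =
    2 * \tr (y^T *m B *m c) - x * \tr (y^T *m B *m y).
  have E4 : \tr (c^T *m B *m y) = \tr (y^T *m B *m c).
    rewrite !mxtrace_trmx_mul3 exchange_big; apply: eq_bigr => i _.
    by apply: eq_bigr => l _; apply: eq_bigr => j _; rewrite B_sym mulrC; ring.
  rewrite mulr2n mulrDl mul1r -{2}E4 !mxtrace_trmx_mul3.
  rewrite mulr_sumr -sumrN -!big_split; apply: eq_bigr => i _ /=.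
  rewrite mulr_sumr -sumrN -!big_split; apply: eq_bigr => l _ /=.
  rewrite mulr_sumr -sumrN -!big_split; apply: eq_bigr => j _ /=; ring.
rewrite -E1 -E2 -E3 -subr_ge0 !mulr_sumr -!sumrN -!big_split -sumrN -big_split.
apply: sumr_ge0 => i _ /=.
rewrite !mulr_sumr -!sumrN -!big_split -sumrN -big_split.
apply: sumr_ge0 => j _ /=.
have := mix_gt0 (a0 j) (t0 i) x01.
set z := (X in 0 <= X) => D0.
(* In the same coordinates [T] has the entries [C i j * t 0 i], so the gap is a weighted square in
   each entry. *)
have -> : z = mix (a 0 j) (t 0 i) x *
    (C i j * t 0 i / mix (a 0 j) (t 0 i) x - y' i j) ^+ 2.
  rewrite /z; move: (y' i j) (C i j) D0 => {z} z w.
  by rewrite /mix => /lt0r_neq0 D0; field.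
by rewrite mulr_ge0 ?sqr_ge0// ltW.
Qed.

(** Both sides are [tr T]; this is the term subtracted in the numerator of the integrands. *)
Let trace_T : \sum_i \sum_j C i j ^+ 2 * t 0 i =
  \sum_i \sum_l \sum_j B i l * (c i j * c l j).
Proof.
rewrite -mxtrace_trmx_mul3.
transitivity (\tr (C^T *m diag_mx t *m C)).
  rewrite mxtrace_diag_mul3; apply: eq_bigr => i _; apply: eq_bigr => j _.
  by rewrite -expr2 mulrC.
rewrite /C /c /B /T !trmx_mul !trmxK -[LHS](mxtrace_conj _ VV).
rewrite -[RHS](mxtrace_conj _ VV0) !mulmxA VV VV0 !mul1mx UU0 mul1mx.
rewrite -!(mulmxA _ V V^T) -!(mulmxA _ V0 V0^T) VV VV0 !mulmx1.
by rewrite -(mulmxA _ U0) UU0 mulmx1.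
Qed.

(* The right-hand side is [tr (T (log T - log A))]; the left-hand side is its
   tangent at [(T0, A0)], where [T0] and [A0] have the eigenbases [U0], [V0] and
   the eigenvalues [tau], [al]. *)
Lemma relative_entropy_tangent :
  \sum_i \sum_l \sum_j
      B i l * (c i j * c l j) * (xln_ddiff (tau 0 i) (tau 0 l) - ln (al 0 j))
  - \sum_i \sum_j \sum_k
      A' j k * (c i j * c i k) * (tau 0 i * ln_ddiff (al 0 j) (al 0 k))
  <= \sum_i \sum_j C i j ^+ 2 * (t 0 i * (ln (t 0 i) - ln (a 0 j))).
Proof.
rewrite -subr_ge0 opprB.
have I1 := has_integral01_sum (fun i => has_integral01_sum (fun j =>
  has_integral01Z (C i j ^+ 2) (has_integral01_ln (a0 j) (t0 i)))).
have I2 := has_integral01_sum (fun i => has_integral01_sum (fun l =>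
  has_integral01_sum (fun j => has_integral01Z (B i l * (c i j * c l j))
    (has_integral01_xln_ddiff (al0 j) (tau0 i) (tau0 l))))).
have I3 := has_integral01_sum (fun i => has_integral01_sum (fun j =>
  has_integral01_sum (fun k => has_integral01Z (A' j k * (c i j * c i k))
    (has_integral01_ln_ddiff (al0 j) (al0 k) (tau0 i))))).
have := has_integral01D I1 (has_integral01D I3 (has_integral01Z (-1) I2)).
rewrite mulN1r => /has_integral01_ge0; apply => x /andP[x0 x1].
have x01 : 0 <= x <= 1 by rewrite !ltW.
have x1' : 0 < 1 - x by rewrite subr_gt0.
(* The optimal [Y] for [(T, A) = (T0, A0)], namely [M^-1 T0]. *)
pose y : 'M[R]_d := \matrix_(i, j) (tau 0 i * c i j / mix (al 0 j) (tau 0 i) x).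
(* Multiplied by [1 - x > 0], the integrand is exactly the gap in [quadratic_bound] at [y]; the two
   copies of [tr T] cancel by [trace_T]. *)
rewrite -(pmulr_rge0 _ x1') mulN1r.
have := quadratic_bound y x01; rewrite -subr_ge0.
congr (0 <= _).
have E1 : (1 - x) * \sum_i \sum_j C i j ^+ 2 *
    (t 0 i * (t 0 i - a 0 j) / mix (a 0 j) (t 0 i) x) =
  \sum_i \sum_j C i j ^+ 2 * (t 0 i ^+ 2 / mix (a 0 j) (t 0 i) x) -
  \sum_i \sum_j C i j ^+ 2 * t 0 i.
  rewrite mulr_sumr -sumrN -big_split; apply: eq_bigr => i _ /=.
  rewrite mulr_sumr -sumrN -big_split; apply: eq_bigr => j _ /=.
  have := mix_gt0 (a0 j) (t0 i) x01; move: (C i j) => z.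
  by rewrite /mix => /lt0r_neq0 D0; field.
have E2 : (1 - x) * \sum_i \sum_l \sum_j B i l * (c i j * c l j) *
    ((tau 0 i * tau 0 l - (1 - x) * (tau 0 i - al 0 j) * (tau 0 l - al 0 j)) /
     (mix (al 0 j) (tau 0 i) x * mix (al 0 j) (tau 0 l) x)) =
  \sum_i \sum_l \sum_j B i l *
    (y i j * c l j + c i j * y l j - x * (y i j * y l j)) -
  \sum_i \sum_l \sum_j B i l * (c i j * c l j).
  rewrite mulr_sumr -sumrN -big_split; apply: eq_bigr => i _ /=.
  rewrite mulr_sumr -sumrN -big_split; apply: eq_bigr => l _ /=.
  rewrite mulr_sumr -sumrN -big_split; apply: eq_bigr => j _ /=.
  have := mix_gt0 (al0 j) (tau0 i) x01; have := mix_gt0 (al0 j) (tau0 l) x01.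
  rewrite !mxE /=; move: (\sum_(_ < _) _) (\sum_(_ < _) _) (\sum_(_ < _) _).
  move=> z1 z2 z3.
  by rewrite /mix => /lt0r_neq0 D0 /lt0r_neq0 D1; field; rewrite D0 D1.
have E3 : \sum_i \sum_j \sum_k A' j k * (c i j * c i k) *
    (tau 0 i ^+ 2 / (mix (al 0 j) (tau 0 i) x * mix (al 0 k) (tau 0 i) x)) =
  \sum_i \sum_j \sum_k A' j k * (y i j * y i k).
  apply: eq_bigr => i _; apply: eq_bigr => j _; apply: eq_bigr => k _.
  have := mix_gt0 (al0 j) (tau0 i) x01; have := mix_gt0 (al0 k) (tau0 i) x01.
  rewrite [y i j]mxE [y i k]mxE.
  move: (A' j k) (c i j) (c i k) => z1 z2 z3.
  by rewrite /mix => /lt0r_neq0 D0 /lt0r_neq0 D1; field; rewrite D0 D1.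
rewrite E3 !mulrDr mulrN E1 E2 trace_T; ring.
Qed.

End relative_entropy.

(** * The tangent form of Lieb's theorem *)

Section lieb.
Variables (R : realType) (d : nat).
Implicit Types (A H L Q U V X : 'M[R]_d) (v w : 'rV[R]_d).

Lemma orth_row_dot Q i l : Q *m Q^T = 1%:M ->
  \sum_j Q i j * Q l j = (i == l)%:R.
Proof.
move=> /matrixP/(_ i l); rewrite !mxE => <-.
by apply: eq_bigr => j _; rewrite mxE.
Qed.

Lemma orth_mulT U V : U *m U^T = 1%:M -> V *m V^T = 1%:M ->
  (U^T *m V) *m (U^T *m V)^T = 1%:M.
Proof.
move=> UU VV.
by rewrite trmx_mul trmxK mulmxA -(mulmxA U^T) VV mulmx1 (mulmx1C UU).
Qed.

Lemma orth_row_sum U V i : U *m U^T = 1%:M -> V *m V^T = 1%:M ->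
  \sum_j (U^T *m V) i j ^+ 2 = 1.
Proof.
move=> UU VV; under eq_bigr do rewrite expr2.
by rewrite orth_row_dot ?eqxx// orth_mulT.
Qed.

Lemma mxtrace_conj_mul Q L A :
  \tr (Q *m L *m Q^T *m A) = \tr (L *m (Q^T *m A *m Q)).
Proof. by rewrite -!mulmxA mxtrace_mulC !mulmxA. Qed.

Lemma conjT_conj Q A : Q *m Q^T = 1%:M -> Q^T *m (Q *m A *m Q^T) *m Q = A.
Proof.
by move=> QQ; rewrite !mulmxA (mulmx1C QQ) mul1mx -mulmxA (mulmx1C QQ) mulmx1.
Qed.

Lemma mul_orth_diag Q v w : Q *m Q^T = 1%:M ->
  (Q *m diag_mx v *m Q^T) *m (Q *m diag_mx w *m Q^T) =
  Q *m diag_mx (\row_i (v 0 i * w 0 i)) *m Q^T.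
Proof.
move=> QQ; rewrite !mulmxA -(mulmxA _ Q^T Q) (mulmx1C QQ) mulmx1.
by rewrite -(mulmxA Q (diag_mx v)) mulmx_diag.
Qed.

(** Apply [relative_entropy_tangent] with [T = exp (H + X)] and [A = exp X]. The relative entropy is
    [tr (T H)] and its tangent is [tr (T H) + tr T - tr (L A)], so [tr T <= tr (L A)]. That [L] is
    fixed before [X] is what lets an expectation pass through the bound. *)
Lemma lieb_tangent H A0 V0 al : H^T = H -> orth_diag A0 V0 al ->
  (forall i, 0 < al 0 i) ->
  exists L,
    (forall X, X^T = X -> \tr (mxexp (H + X)) <= \tr (L *m mxexp X)) /\
    \tr (L *m A0) = \tr (mxexp (H + mxlog A0)).
Proof.
move=> HT oA0 al0; have [VV0 A0E] := oA0.
have lE : mxlog A0 = V0 *m diag_mx (map_mx (@ln R) al) *m V0^T by exact: mxfunE.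
have lT : (mxlog A0)^T = mxlog A0.
  by rewrite lE !trmx_mul trmxK tr_diag_mx mulmxA.
have [U0 [kap [UU0 HlE]]] : exists Q v, orth_diag (H + mxlog A0) Q v.
  by apply: sym_orth_diag; rewrite linearD /= HT lT.
pose c := U0^T *m V0; pose tau := map_mx (@expR R) kap.
have tau0 i : 0 < tau 0 i by rewrite mxE expR_gt0.
(* The derivative of [log] at [A0] in the direction [exp (H + log A0)], in the
   eigenbasis of [A0]. *)
pose La : 'M[R]_d := \matrix_(j, k)
  (ln_ddiff (al 0 j) (al 0 k) * \sum_i tau 0 i * (c i j * c i k)).
have T0E : mxexp (H + mxlog A0) = U0 *m diag_mx tau *m U0^T by exact: mxfunE.
exists (V0 *m La *m V0^T); split; last first.
  (* [A0] is diagonal in the basis [V0], so only the diagonal of [La] enters. There [ln_ddiff] is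
     the inverse of the eigenvalue, and the rows of [c] have norm 1. *)
  rewrite T0E mxtrace_conj// mxtrace_diag.
  rewrite mxtrace_conj_mul A0E conjT_conj// mul_mx_diag /mxtrace.
  under eq_bigr do rewrite !mxE /ln_ddiff eqxx mulrAC mulVf ?gt_eqF// mul1r.
  rewrite exchange_big; apply: eq_bigr => i _.
  rewrite -mulr_sumr; under eq_bigr do rewrite -expr2.
  by rewrite orth_row_sum// mulr1.
move=> X XT.
have [U [mu [UU HXE]]] : exists Q v, orth_diag (H + X) Q v.
  by apply: sym_orth_diag; rewrite linearD /= HT XT.
have [V [nu [VV XE]]] := sym_orth_diag XT.
pose t := map_mx (@expR R) mu; pose a := map_mx (@expR R) nu.
have t0 i : 0 < t 0 i by rewrite mxE expR_gt0.
have a0 i : 0 < a 0 i by rewrite mxE expR_gt0.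
set T := mxexp (H + X).
have TE : T = U *m diag_mx t *m U^T by exact: mxfunE.
have eXE : mxexp X = V *m diag_mx a *m V^T by exact: mxfunE.
have := relative_entropy_tangent UU VV UU0 VV0 t0 a0 tau0 al0.
rewrite -TE -eXE -/c.
(* Here [log T - log A = (H + X) - X = H]. *)
have -> : \sum_i \sum_j (U^T *m V) i j ^+ 2 *
      (t 0 i * (ln (t 0 i) - ln (a 0 j))) =
    \tr (T *m H).
  have -> : H = (H + X) - X by rewrite addrK.
  rewrite mulmxBr raddfB /= HXE TE mul_orth_diag// mxtrace_conj// mxtrace_diag.
  rewrite XE mxtrace_orth_diag2 -sumrB; apply: eq_bigr => i _.
  rewrite [in RHS]mxE -[X in _ = X - _]mulr1 -(orth_row_sum i UU VV).
  rewrite mulr_sumr -sumrB.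
  by apply: eq_bigr => j _; rewrite [t 0 i]mxE [a 0 j]mxE !expRK; ring.
set B := U0^T *m T *m U0.
(* Orthonormality of the rows of [c] leaves [l = i] in the first part, where [xln_ddiff] is
   [kap 0 i + 1]. The sum is thus [tr (T (log T0 + 1 - log A0))], and [log T0 - log A0 = H]. *)
have -> : \sum_i \sum_l \sum_j B i l * (c i j * c l j) *
      (xln_ddiff (tau 0 i) (tau 0 l) - ln (al 0 j)) = \tr (T *m H) + \tr T.
  have -> : H = (H + mxlog A0) - mxlog A0 by rewrite addrK.
  have -> : \tr (T *m (H + mxlog A0 - mxlog A0)) + \tr T =
      \sum_i B i i * (kap 0 i + 1) -
      \sum_i \sum_l \sum_j B i l * (c i j * c l j) * ln (al 0 j).
    rewrite mulmxBr raddfB /= addrAC; congr (_ - _).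
      rewrite HlE mxtrace_mulC mxtrace_conj_mul -/B mul_diag_mx.
      rewrite -[X in _ + X](mxtrace_conjT _ UU0) -/B /mxtrace -big_split.
      by apply: eq_bigr => i _; rewrite mxE /=; ring.
    rewrite lE mxtrace_mulC mxtrace_conj_mul.
    transitivity (\tr (c^T *m B *m (c *m diag_mx (map_mx (@ln R) al)))).
      rewrite mxtrace_mulC /c /B trmx_mul trmxK !mulmxA -(mulmxA _ U0 U0^T) UU0.
      by rewrite mulmx1 -(mulmxA _ U0 U0^T) UU0 mulmx1.
    rewrite mxtrace_trmx_mul3; apply: eq_bigr => i _; apply: eq_bigr => l _.
    apply: eq_bigr => j _; rewrite mul_mx_diag [(\matrix_(_, _) _) l j]mxE.
    by rewrite [map_mx _ _ _ _]mxE; ring.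
  rewrite -sumrB; apply: eq_bigr => i _.
  have cc l : \sum_j c i j * c l j = (i == l)%:R.
    exact/orth_row_dot/orth_mulT.
  transitivity (\sum_l (B i l * xln_ddiff (tau 0 i) (tau 0 l) * (i == l)%:R -
    \sum_j B i l * (c i j * c l j) * ln (al 0 j))).
    apply: eq_bigr => l _; rewrite -cc mulr_sumr -sumrB.
    by apply: eq_bigr => j _; ring.
  rewrite sumrB; congr (_ - _); rewrite (bigD1 i)//= eqxx mulr1 big1 ?addr0.
    by rewrite /xln_ddiff eqxx [tau 0 i]mxE expRK.
  by move=> l li; rewrite eq_sym (negPf li) mulr0.
set s := \sum_i \sum_j _.
have -> : s = \tr (V0 *m La *m V0^T *m mxexp X).
  rewrite mxtrace_conj_mul /s exchange_big /mxtrace; apply: eq_bigr => j _ /=.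
  rewrite exchange_big mxE; apply: eq_bigr => k _ /=.
  have -> : (V0^T *m mxexp X *m V0) j k = (V0^T *m mxexp X *m V0) k j.
    have : (V0^T *m mxexp X *m V0)^T = V0^T *m mxexp X *m V0.
      by rewrite eXE !trmx_mul !trmxK tr_diag_mx !mulmxA.
    by move=> {1}<-; rewrite mxE.
  rewrite [La j k]mxE mulr_sumr mulr_suml; apply: eq_bigr => i _; ring.
lra.
Qed.

End lieb.

(** * Exponentials and the smallest eigenvalue *)

Section functional_calculus.
Variables (R : realType) (d : nat).
Implicit Types (A H L Q U V X : 'M[R]_d) (v w : 'rV[R]_d) (s t : R).

Lemma orth_diag_eigenvalue A Q v i : orth_diag A Q v -> eigenvalue A (v 0 i).
Proof.
move=> [QQ AE]; apply/eigenvalueP; exists (row i Q^T).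
  rewrite AE rowE !mulmxA -(mulmxA _ Q^T Q) (mulmx1C QQ) mulmx1 -!rowE.
  by rewrite row_diag_mx -scalemxAl -rowE.
apply/eqP => r0; have : (Q^T *m Q) i i = 0.
  rewrite mxE big1// => j _; have /rowP/(_ j) := r0.
  by rewrite [LHS]mxE => ->; rewrite mxE mul0r.
by rewrite (mulmx1C QQ) mxE eqxx => /eqP; rewrite oner_eq0.
Qed.

Lemma eigenvalue_orth_diag A Q v a : orth_diag A Q v -> eigenvalue A a ->
  exists i, a = v 0 i.
Proof.
move=> [QQ AE] /eigenvalueP[x xA x0].
have xQ : (x *m Q) *m diag_mx v = a *: (x *m Q).
  by rewrite scalemxAl -xA AE !mulmxA -(mulmxA _ Q^T Q) (mulmx1C QQ) mulmx1.
have xQ0 : x *m Q != 0.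
  by apply: contraNneq x0 => xQ0; rewrite -[x]mulmx1 -QQ mulmxA xQ0 mul0mx.
have [i xi] : exists i, (x *m Q) 0 i != 0.
  apply/existsP; rewrite -negb_forall; apply: contraNN xQ0 => /forallP h.
  by apply/eqP/rowP => i; rewrite [RHS]mxE; apply/eqP.
exists i; move/rowP/(_ i): xQ; rewrite mul_mx_diag mxE [in RHS]mxE mulrC.
by move/(mulIf xi).
Qed.

Lemma le_lambda_minP A Q v t : (0 < d)%N -> orth_diag A Q v ->
  (t <= lambda_min A <-> forall i, t <= v 0 i).
Proof.
move=> d0 oA; split => [tA i|tv].
  apply: le_trans tA _; apply: ge_inf; last exact: orth_diag_eigenvalue oA.
  (* The infimum is a lower bound only for a set bounded below; this is one such bound for the
     eigenvalues. *)
  exists (\sum_i - `|v 0 i|) => a /(eigenvalue_orth_diag oA)[j ->].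
  rewrite (bigD1 j)//= -[leRHS]addr0; apply: lerD; first exact: lerNnormlW.
  by apply: sumr_le0 => k _; rewrite oppr_le0.
apply: lb_le_inf; last by move=> a /(eigenvalue_orth_diag oA)[j ->].
by exists (v 0 (Ordinal d0)); exact: orth_diag_eigenvalue oA.
Qed.

Lemma orth_diagZ s A Q v : orth_diag A Q v -> orth_diag (s *: A) Q (s *: v).
Proof.
by move=> [QQ ->]; split=> //; rewrite linearZ /= -scalemxAr -scalemxAl.
Qed.

Lemma orth_diag_shift s A Q v : orth_diag A Q v ->
  orth_diag (s%:M + A) Q (const_mx s + v).
Proof.
move=> [QQ ->]; split=> //; rewrite linearD /= mulmxDr mulmxDl; congr (_ + _).
by rewrite diag_const_mx mul_mx_scalar -scalemxAl QQ scalemx1.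
Qed.

Lemma mxfun_entry f A Q v i j : orth_diag A Q v ->
  mxfun f A i j = \sum_k Q i k * f (v 0 k) * Q j k.
Proof.
move=> oA; rewrite (mxfunE f oA) mxE; apply: eq_bigr => k _.
by rewrite mul_mx_diag [in LHS]mxE [map_mx _ _ _ _]mxE [Q^T _ _]mxE.
Qed.

Lemma mxtrace_mxexp A Q v : orth_diag A Q v ->
  \tr (mxexp A) = \sum_i expR (v 0 i).
Proof.
move=> oA; have [QQ _] := oA; rewrite /mxexp (mxfunE _ oA) mxtrace_conj//.
by rewrite mxtrace_diag; apply: eq_bigr => i _; rewrite mxE.
Qed.

Lemma mxtrace_mxexp_ge0 A : A^T = A -> 0 <= \tr (mxexp A).
Proof.
move=> /sym_orth_diag[Q [v oA]]; rewrite (mxtrace_mxexp oA) sumr_ge0// => i _.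

Qed.

(** All [d] eigenvalues are at least [t], and each contributes to the trace; this is the source of
    the factor [1 / d] in the theorem. *)
Lemma le_lambda_min_mxexp A t s : (0 < d)%N -> A^T = A -> 0 <= s ->
  t <= lambda_min A -> d%:R * expR (s * t) <= \tr (mxexp (s *: A)).
Proof.
move=> d0 /sym_orth_diag[Q [v oA]] s0 /(le_lambda_minP _ d0 oA) tv.
rewrite (mxtrace_mxexp (orth_diagZ s oA)).
rewrite -[X in X%:R]card_ord -sum1_card natr_sum mulr_suml.
by apply: ler_sum => i _; rewrite mul1r mxE ler_expR ler_wpM2l.
Qed.

(* Only countably many conditions, each of which is measurable in [A]. *)
Lemma le_lambda_min_mxtraceP A t : (0 < d)%N -> A^T = A ->
  t <= lambda_min A <->
  forall m : nat, \tr (mxexp (m%:R *: (t%:M + (-1) *: A))) <= d%:R.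
Proof.
move=> d0 /sym_orth_diag[Q [v oA]].
have oB m := orth_diagZ m%:R (orth_diag_shift t (orth_diagZ (-1) oA)).
rewrite (le_lambda_minP _ d0 oA); split => [tv m|tm i].
  rewrite (mxtrace_mxexp (oB m)) -[X in _ <= X%:R]card_ord -sum1_card natr_sum.
  apply: ler_sum => i _; rewrite !mxE mulN1r -expR0 ler_expR.
  by rewrite mulr_ge0_le0// subr_le0.
rewrite leNgt; apply/negP => vt.
have vt0 : 0 < t - v 0 i by rewrite subr_gt0.
(* For an eigenvalue below [t] the trace grows at least linearly in [m], because [expR y >= 1 + y];
   this [m] makes it exceed [d]. *)
pose m := Num.bound (d%:R / (t - v 0 i)).
have dm : d%:R < m%:R * (t - v 0 i).
  by rewrite -ltr_pdivrMr// archi_boundP// divr_ge0// ltW.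
have := tm m; rewrite (mxtrace_mxexp (oB m)) leNgt => /negP; apply.
apply: (lt_le_trans dm); rewrite (bigD1 i)//= -[leLHS]addr0 lerD//.
  by rewrite !mxE mulN1r (le_trans _ (expR_ge1Dx _))// lerDr.
by rewrite sumr_ge0// => j _; exact: expR_ge0.
Qed.

Lemma orth_diagX A Q v n : orth_diag A Q v ->
  orth_diag (A ^+ n) Q (map_mx (fun x => x ^+ n) v).
Proof.
move=> [QQ AE]; split=> //; elim: n => [|n IH].
  rewrite expr0 (_ : map_mx _ v = const_mx 1); last first.
    by apply/rowP => i; rewrite !mxE expr0.
  by rewrite diag_const_mx mulmx1 QQ.
rewrite exprS IH [in LHS]AE -[LHS]/((_ *m _) *m _) mul_orth_diag//.
congr (_ *m diag_mx _ *m _).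
by apply/rowP => i; rewrite !mxE exprS.
Qed.

(** In an eigenbasis the partial sums are those of the scalar exponential series at the
    eigenvalues. *)
Lemma cvg_mxexp A i j : A^T = A ->
  (fun N => \sum_(0 <= n < N) (n`!%:R)^-1 * (A ^+ n) i j) @ \oo --> mxexp A i j.
Proof.
move=> /sym_orth_diag[Q [v oA]]; rewrite (mxfun_entry _ _ _ oA).
have -> : (fun N => \sum_(0 <= n < N) (n`!%:R)^-1 * (A ^+ n) i j) =
  (fun N => \sum_k Q i k * series (exp_coeff (v 0 k)) N * Q j k).
  apply/funext => N; rewrite /series /=.
  under [RHS]eq_bigr do rewrite mulr_sumr mulr_suml.
  rewrite exchange_big; apply: eq_bigr => n _.
  have [QQ AE] := orth_diagX n oA.
  rewrite AE mxE mulr_sumr; apply: eq_bigr => k _.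
  rewrite mul_mx_diag [in LHS]mxE [map_mx _ _ _ _]mxE [Q^T _ _]mxE.
  by rewrite /exp_coeff /=; ring.
elim: (index_enum _) => [|k s IH].
  by rewrite big_nil; under eq_fun do rewrite big_nil; exact: cvg_cst.
rewrite big_cons; under eq_fun do rewrite big_cons.
apply: cvgD => //; apply: cvgM; last exact: cvg_cst.
by apply: cvgM; [exact: cvg_cst|exact: is_cvg_series_exp_coeff].
Qed.

End functional_calculus.

(** * Measurability and Jensen's inequality *)

Section matrix_measurability.
Context (disp : measure_display) (T : measurableType disp).
Context (R : realType) (d : nat).
Implicit Types (Y Z : T -> 'M[R]_d).

Definition entry_measurable Y : Prop :=
  forall i j, measurable_fun setT (fun w => Y w i j).

Lemma entry_measurableD Y Z : entry_measurable Y -> entry_measurable Z ->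
  entry_measurable (fun w => Y w + Z w).
Proof.
move=> mY mZ i j; under eq_fun do rewrite mxE.
exact: measurable_funD.
Qed.

Lemma entry_measurableZ s Y : entry_measurable Y ->
  entry_measurable (fun w => s *: Y w).
Proof.
move=> mY i j; under eq_fun do rewrite mxE.
exact: measurable_funM.
Qed.

Lemma entry_measurable_cst (A : 'M[R]_d) : entry_measurable (cst A).
Proof. by move=> i j; exact: measurable_cst. Qed.

Lemma entry_measurable_sum (I : Type) (r : seq I) (F : I -> T -> 'M[R]_d) :
  (forall k, entry_measurable (F k)) ->
  entry_measurable (fun w => \sum_(k <- r) F k w).
Proof.
move=> mF i j; under eq_fun do rewrite summxE.
by apply: measurable_sum => k; exact: mF.
Qed.

Lemma entry_measurableX Y n : entry_measurable Y ->
  entry_measurable (fun w => Y w ^+ n).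
Proof.
move=> mY; elim: n => [|n IH]; first exact: entry_measurable_cst.
move=> i j; under eq_fun do rewrite exprS mxE.
by apply: measurable_sum => k; exact: measurable_funM.
Qed.

(** The diagonalizations behind [mxexp] are not chosen measurably in [w], so measurability is
    obtained from the power series instead. *)
Lemma entry_measurable_mxexp Y : (forall w, (Y w)^T = Y w) ->
  entry_measurable Y -> entry_measurable (fun w => mxexp (Y w)).
Proof.
move=> sY mY i j.
apply: (@measurable_fun_cvg _ _ _ setT (fun N w =>
  \sum_(0 <= n < N) (n`!%:R)^-1 * (Y w ^+ n) i j)); last first.
  by move=> w _; exact: cvg_mxexp.
move=> N; apply: measurable_sum => n; apply: measurable_funM => //.
exact: entry_measurableX.
Qed.

Lemma measurable_mxtrace_mxexp Y : (forall w, (Y w)^T = Y w) ->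
  entry_measurable Y -> measurable_fun setT (fun w => \tr (mxexp (Y w))).
Proof.
move=> sY mY; apply: measurable_sum => i; exact: entry_measurable_mxexp.
Qed.

Lemma measurable_le_lambda_min Y t : (0 < d)%N -> (forall w, (Y w)^T = Y w) ->
  entry_measurable Y -> measurable [set w | t <= lambda_min (Y w)].
Proof.
move=> d0 sY mY.
rewrite (_ : mkset _ = \bigcap_(m : nat)
  [set w | \tr (mxexp (m%:R *: (t%:M + (-1) *: Y w))) <= d%:R]); last first.
  apply/seteqP; split => w /=.
    by move=> /(le_lambda_min_mxtraceP t d0 (sY w)) h m _; exact: h.
  by move=> h; apply/(le_lambda_min_mxtraceP t d0 (sY w)) => m; exact: h.
apply: bigcapT_measurable => m; rewrite -[X in measurable X]setTI.
apply: measurable_fun_ler => //.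
apply: measurable_mxtrace_mxexp.
  by move=> w; rewrite linearZ /= linearD /= linearZ /= tr_scalar_mx sY.
apply: entry_measurableZ; apply: entry_measurableD.
  exact: entry_measurable_cst.
exact: entry_measurableZ.
Qed.

End matrix_measurability.

(** * Jensen's inequality for the trace exponential *)

Section lieb_jensen.
Context (disp : measure_display) (T : measurableType disp) (R : realType).
Context (P : probability T R) (d : nat).
Implicit Types (Z M : T -> 'M[R]_d) (L : 'M[R]_d).

Lemma mxtrace_mulE (A B : 'M[R]_d) : \tr (A *m B) = \sum_i \sum_j A i j * B j i.
Proof. by apply: eq_bigr => i _; rewrite mxE. Qed.

Lemma integrable_mxtrace_mul L M : integrable_mx P M ->
  P.-integrable setT (fun w => (\tr (L *m M w))%:E).
Proof.
move=> iM; under eq_fun do rewrite mxtrace_mulE -sumEFin.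
apply: integrable_sum => // i _; under eq_fun do rewrite -sumEFin.
apply: integrable_sum => // j _; under eq_fun do rewrite EFinM.
by apply: integrableZl => //; exact: iM.
Qed.

Lemma integral_mxtrace_mul L M : integrable_mx P M ->
  (\int[P]_w (\tr (L *m M w))%:E = (\tr (L *m expectation_mx P M))%:E)%E.
Proof.
move=> iM; under eq_integral do rewrite mxtrace_mulE -sumEFin.
rewrite integral_sum//; last first.
  move=> i; under eq_fun do rewrite -sumEFin.
  apply: integrable_sum => // j _; under eq_fun do rewrite EFinM.
  by apply: integrableZl => //; exact: iM.
rewrite mxtrace_mulE -sumEFin; apply: eq_bigr => i _.
under eq_integral do rewrite -sumEFin.
rewrite integral_sum//; last first.
  move=> j; under eq_fun do rewrite EFinM.
  by apply: integrableZl => //; exact: iM.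
rewrite -sumEFin; apply: eq_bigr => j _.
under eq_integral do rewrite EFinM.
rewrite integralZl//; last exact: iM.
rewrite EFinM mxE unlock fineK//; apply: integrable_fin_num => //; exact: iM.
Qed.

(** If the integral were 0, then [f] would vanish almost everywhere, and the whole space would be a
    null set. *)
Lemma integral_gt0 (f : T -> R) :
  measurable_fun setT f -> (forall w, 0 < f w) ->
  (0 < \int[P]_w (f w)%:E)%E.
Proof.
move=> mf f0; rewrite lt_neqAle integral_ge0 ?andbT; last first.
  by move=> w _; rewrite lee_fin ltW.
apply/eqP => /esym If.
have : (\int[P]_w `|(EFin \o f) w| = 0)%E.
  rewrite -[RHS]If; apply: eq_integral => w _.
  by rewrite gee0_abs// lee_fin ltW.
move/ae_eq_integral_abs => /(_ measurableT).
have mEf : measurable_fun setT (EFin \o f) by exact/measurable_EFinP.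
move=> /(_ mEf) [N [mN PN]] sub.
have NT : N = setT.
  rewrite -subTset; apply: subset_trans sub => w _ /= /(_ I) [fw].
  by have := f0 w; rewrite fw ltxx.
have := @probability_setT _ _ _ P.
by rewrite -NT PN => -[] /esym/eqP; rewrite oner_eq0.
Qed.

(** An eigenvalue of the expectation is [tr (L E)] for the projection [L] onto its eigenvector,
    hence the expectation of a positive function. This puts the logarithm of the expectation in its
    proper domain. *)
Lemma expectation_mxexp_posdef Z : (forall w, (Z w)^T = Z w) ->
  entry_measurable Z -> integrable_mx P (fun w => mxexp (Z w)) ->
  exists Q v, orth_diag (expectation_mx P (fun w => mxexp (Z w))) Q v /\
    forall i, 0 < v 0 i.
Proof.
move=> sZ mZ iZ; set E := expectation_mx _ _.
have [Q [v oE]] : exists Q v, orth_diag E Q v.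
  apply: sym_orth_diag; apply/matrixP => i j; rewrite !mxE; congr (fine _).
  rewrite unlock; apply: eq_integral => w _; congr (_%:E).
  have [V [nu oZ]] := sym_orth_diag (sZ w).
  by rewrite !(mxfun_entry _ _ _ oZ); apply: eq_bigr => k _; ring.
exists Q, v; split=> // i; have [QQ EE] := oE.
pose L := Q *m diag_mx (delta_mx 0 i) *m Q^T.
have -> : v 0 i = \tr (L *m E).
  rewrite EE mul_orth_diag// mxtrace_conj// mxtrace_diag (bigD1 i)//=.
  rewrite !mxE !eqxx.
  by rewrite mul1r big1 ?addr0// => j ji; rewrite !mxE (negPf ji) andbF mul0r.
rewrite -lte_fin -integral_mxtrace_mul//; apply: integral_gt0.
  by have /measurable_int/measurable_EFinP := integrable_mxtrace_mul L iZ.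
move=> w; have [V [nu oZ]] := sym_orth_diag (sZ w); have [VV _] := oZ.
rewrite /mxexp (mxfunE _ oZ) mxtrace_orth_diag2 (bigD1 i)//=.
apply: ltr_pwDl.
  rewrite lt_neqAle sumr_ge0 ?andbT.
    (* If the sum vanished, row [i] of [Q^T V] would be 0, yet it has norm 1. *)
    rewrite eq_sym; apply/eqP => /eqP; rewrite psumr_eq0; last first.
      by move=> j _; rewrite !mxE !eqxx mul1r mulr_ge0 ?sqr_ge0 ?expR_ge0.
    move=> /allP h; have := orth_row_sum i QQ VV; rewrite big1.
      by move/eqP; rewrite eq_sym oner_eq0.
    move=> j _; have := h j (mem_index_enum _); rewrite /= !mxE !eqxx mul1r.
    by rewrite mulf_eq0 (gt_eqF (expR_gt0 _)) orbF => /eqP ->.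
  by move=> j _; rewrite !mxE !eqxx mul1r mulr_ge0 ?sqr_ge0 ?expR_ge0.
apply: sumr_ge0 => k ki; apply: sumr_ge0 => j _.
by rewrite mulr_ge0 ?sqr_ge0// !mxE mulr_ge0 ?expR_ge0.
Qed.

(** The tangent at the mean is integrated: the trace against [L] commutes with the expectation, and
    the tangent touches there. *)
Lemma lieb_jensen (H : 'M[R]_d) Z : H^T = H -> (forall w, (Z w)^T = Z w) ->
  entry_measurable Z -> integrable_mx P (fun w => mxexp (Z w)) ->
  (\int[P]_w (\tr (mxexp (H + Z w)))%:E <=
   (\tr (mxexp (H + mxlog (expectation_mx P (fun w => mxexp (Z w))))))%:E)%E.
Proof.
move=> sH sZ mZ iZ.
have [Q [v [oE v0]]] := expectation_mxexp_posdef sZ mZ iZ.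
have [L [tang <-]] := lieb_tangent sH oE v0.
rewrite -integral_mxtrace_mul//; apply: ge0_le_integral => //.
- by move=> w _; rewrite lee_fin mxtrace_mxexp_ge0// linearD /= sH sZ.
- apply/measurable_EFinP; apply: measurable_mxtrace_mxexp.
    by move=> w; rewrite linearD /= sH sZ.
  by apply: entry_measurableD => //; exact: entry_measurable_cst.
- by have /measurable_int := integrable_mxtrace_mul L iZ.
- by move=> w _; rewrite lee_fin tang.
Qed.

End lieb_jensen.

(** * Independence *)

Section independence.
Context (disp d1 d2 : measure_display) (T : measurableType disp).
Context (T1 : measurableType d1) (T2 : measurableType d2) (R : realType).
Variable P : probability T R.

Lemma measurable_fun_integral_pair (X1 : {mfun T >-> T1}) (X2 : {mfun T >-> T2})
    (f : T1 * T2 -> \bar R) :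
  measurable_fun setT f -> (forall z, 0 <= f z)%E ->
  measurable_fun setT (fun w => \int[P]_w' f (X1 w, X2 w'))%E.
Proof.
move=> mf f0.
have mF := measurable_fun_fubini_tonelli_F (m2 := distribution P X2) f mf f0.
have := measurableT_comp mF (@measurable_funPT _ _ _ _ X1).
congr (measurable_fun _ _); apply/funext => w /=.
by rewrite /fubini_F ge0_integral_distribution//; exact: measurable_fun_pair2.
Qed.

(** The law of the pair agrees with the product of the two laws on rectangles, hence everywhere;
    Tonelli's theorem then gives the iterated integral. *)
Lemma ge0_integral_independent (X1 : {mfun T >-> T1}) (X2 : {mfun T >-> T2})
    (f : T1 * T2 -> \bar R) :
  (forall A B, measurable A -> measurable B ->
    P (X1 @^-1` A `&` X2 @^-1` B) = (P (X1 @^-1` A) * P (X2 @^-1` B))%E) ->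
  measurable_fun setT f -> (forall z, 0 <= f z)%E ->
  (\int[P]_w f (X1 w, X2 w) = \int[P]_w \int[P]_w' f (X1 w, X2 w'))%E.
Proof.
move=> ind mf f0.
have mX : measurable_fun setT (fun w => (X1 w, X2 w)).
  by apply: measurable_fun_pair; exact: measurable_funPT.
have mF := measurable_fun_fubini_tonelli_F (m2 := distribution P X2) f mf f0.
transitivity (\int[distribution P X1]_x \int[distribution P X2]_y f (x, y))%E.
  rewrite -[RHS](fubini_tonelli1 f mf f0).
  rewrite -[LHS](ge0_integral_pushforward mX P measurableT mf)//.
  apply: eq_measure_integral => A mA _.
  by apply/esym; apply: product_measure_unique => // B C mB mC; rewrite -ind.
rewrite ge0_integral_distribution//; last first.
  by move=> x; apply: integral_ge0.
apply: eq_integral => w _ /=.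
rewrite ge0_integral_distribution//.
exact: measurable_fun_pair2.
Qed.

End independence.

(** * Independence of one matrix from all the others *)

Section independent_matrices.
Context (disp : measure_display) (T : measurableType disp) (R : realType).
Context (P : probability T R) (I : finType) (d : nat) (X : I -> T -> 'M[R]_d).
Hypotheses (hX : forall k, random_symmx (X k)) (hind : independent_mx P X).

Lemma measurable_borel_mx_entry i j :
  measurable_fun setT (fun x : borel_mx R d => (x : 'M[R]_d) i j).
Proof.
apply: (measurability _ (RGenOpens.measurableE R)) => _ [_ [a [b ->]] <-].
apply: sub_sigma_algebra; rewrite setTI.
apply: open_comp; last exact: interval_open.
by move=> x _; exact: coord_continuous.
Qed.

Lemma entry_measurable_random_symmx k : entry_measurable (X k).
Proof.
move=> i j; exact: (measurableT_comp (measurable_borel_mx_entry i j) (hX k).1).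
Qed.

(* A pi-system generating the sigma-algebra of the [X i] with [i != k]. *)
Definition cylinders_off (k : I) : set (set T) :=
  [set S | exists B : I -> set (borel_mx R d), [/\ forall i, measurable (B i),
    B k = setT & S = \bigcap_i (X i @^-1` B i)]].

Let measurable_preimage i (B : set (borel_mx R d)) :
  measurable B -> measurable (X i @^-1` B).
Proof. by move=> mB; rewrite -[X in measurable X]setTI; exact: (hX i).1. Qed.

Lemma cylinders_off_measurable k : cylinders_off k `<=` measurable.
Proof.
move=> _ [B [mB _ ->]]; apply: fin_bigcap_measurable => [|i _].
  exact: finite_finset.
exact: measurable_preimage.
Qed.

Lemma cylinders_off_setI k : setI_closed (cylinders_off k).
Proof.
move=> _ _ [B [mB Bk ->]] [C [mC Ck ->]]; exists (fun i => B i `&` C i); split.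
- by move=> i; exact: measurableI.
- by rewrite Bk Ck setIT.
- by rewrite -bigcapI.
Qed.

Lemma cylinders_off_setT k : cylinders_off k setT.
Proof.
by exists (fun=> setT); split=> //; apply/seteqP; split.
Qed.

(** As functions of [A], both sides are finite measures that agree on the generating pi-system
    [cylinders_off k]. *)
Lemma independent_off k (A : set T) (C : set (borel_mx R d)) :
  <<s cylinders_off k >> A -> measurable C ->
  P (A `&` X k @^-1` C) = (P A * P (X k @^-1` C))%E.
Proof.
move=> GA mC; have mXC := measurable_preimage k mC.
pose p : R := fine (P (X k @^-1` C)).
have p0 : 0 <= p by rewrite fine_ge0.
have pE : P (X k @^-1` C) = p%:E by rewrite fineK// fin_num_measure.
suff : mrestr P mXC A = mscale (NngNum p0) P A.
  by rewrite /mrestr /mscale /= pE muleC.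
apply: (@g_sigma_algebra_measure_unique _ _ _ _ (@cylinders_off_measurable k)
  (fun=> setT)) GA.
- by move=> _; exact: cylinders_off_setT.
- by rewrite bigcup_const.
- exact: cylinders_off_setI.
- move=> _ [B [mB Bk ->]].
  rewrite -[LHS]/(P (_ `&` X k @^-1` C)) -[RHS]/(p%:E * P _)%E -pE.
  (* The cylinder leaves coordinate [k] free, so [C] can be inserted there and the product rule
     applied to the full family. *)
  pose B' i := if i == k then C else B i.
  rewrite (_ : _ `&` _ = \bigcap_i (X i @^-1` B' i)); last first.
    rewrite /B'; apply/seteqP; split=> w.
      by move=> [Bw Cw] i _; case: eqP => [->|_] //; exact: Bw.
    move=> Bw; split=> [i _|]; last by have := Bw k Logic.I; rewrite eqxx.
    by have := Bw i Logic.I; case: eqP => // -> _; rewrite Bk.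
  have mB' i : measurable (B' i) by rewrite /B'; case: eqP.
  rewrite !hind// (bigD1 k)//= [in RHS](bigD1 k)//= /B' eqxx Bk preimage_setT.
  rewrite probability_setT mul1e; congr (_ * _)%E.
  by apply: eq_bigr => i /negPf ->.
- move=> _; rewrite -[ltLHS]/(P (_ `&` X k @^-1` C)) setTI.
  by rewrite (le_lt_trans (probability_le1 _ _)) ?ltry.
Qed.

(** Since [H] depends only on the other matrices, independence gives an iterated integral whose
    inner part has [H] frozen; [lieb_jensen] bounds that part. *)
Lemma integral_lieb_step k (theta : R)
    (H : g_sigma_algebraType (cylinders_off k) -> 'M[R]_d) :
  (forall w, (H w)^T = H w) -> entry_measurable H ->
  integrable_mx P (fun w => mxexp (theta *: X k w)) ->
  (\int[P]_w (\tr (mxexp (H w + theta *: X k w)))%:E <=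
   \int[P]_w (\tr (mxexp (H w +
     mxlog (expectation_mx P (fun w => mxexp (theta *: X k w))))))%:E)%E.
Proof.
move=> sH mH iX; set L := mxlog _.
pose TG := g_sigma_algebraType (cylinders_off k).
have mid : measurable_fun setT (id : T -> TG).
  move=> _ A mA; rewrite setTI.
  apply: (smallest_sub (@sigma_algebra_measurable _ T)) mA.
  exact: cylinders_off_measurable.
(* The identity into [T] with the smaller sigma-algebra serves as the random variable carrying all
   the other matrices. *)
pose X1 : {mfun T >-> TG} :=
  HB.pack (id : T -> TG) (isMeasurableFun.Build _ _ _ _ _ mid).
pose X2 : {mfun T >-> borel_mx R d} :=
  HB.pack (X k : T -> borel_mx R d) (isMeasurableFun.Build _ _ _ _ _ (hX k).1).
(* [borel_mx] also contains the matrices that are not symmetric, on which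
   [mxexp] takes the junk value 0. *)
pose symm (x : 'M[R]_d) := 2^-1 *: (x + x^T).
have symX w : symm (X k w) = X k w.
  rewrite /symm (hX k).2 -mulr2n -[X k w *+ 2]scaler_nat scalerA.
  by rewrite mulVf// scale1r.
pose g (z : TG * borel_mx R d) := H z.1 + theta *: symm z.2.
have sg z : (g z)^T = g z.
  rewrite /g linearD /= sH linearZ /= linearZ /= linearD /= trmxK.
  by rewrite [z.2^T + _]addrC.
have mg : measurable_fun setT (fun z => (\tr (mxexp (g z)))%:E).
  apply/measurable_EFinP/measurable_mxtrace_mxexp => //.
  apply: entry_measurableD.
    by move=> i j; exact: (measurableT_comp (mH i j) measurable_fst).
  apply: entry_measurableZ; apply: entry_measurableZ; apply: entry_measurableD.
    move=> i j.
    exact: (measurableT_comp (measurable_borel_mx_entry i j) measurable_snd).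
  move=> i j; under eq_fun do rewrite mxE.
  exact: (measurableT_comp (measurable_borel_mx_entry j i) measurable_snd).
have g0 z : (0 <= (\tr (mxexp (g z)))%:E)%E.
  by rewrite lee_fin mxtrace_mxexp_ge0.
have sXk w : (theta *: X k w)^T = theta *: X k w by rewrite linearZ /= (hX k).2.
have mXk : entry_measurable (fun w => theta *: X k w).
  exact/entry_measurableZ/entry_measurable_random_symmx.
have sL : L^T = L.
  have [Q [v [oE _]]] := expectation_mxexp_posdef sXk mXk iX.
  by rewrite /L /mxlog (mxfunE _ oE) !trmx_mul trmxK tr_diag_mx mulmxA.
have mHT : entry_measurable (H : T -> 'M[R]_d).
  by move=> i j; exact: (measurableT_comp (mH i j) mid).
have gE w w' : g (w, X k w') = H w + theta *: X k w' by rewrite /g /= symX.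
have -> : (\int[P]_w (\tr (mxexp (H w + theta *: X k w)))%:E =
    \int[P]_w \int[P]_w' (\tr (mxexp (g (X1 w, X2 w'))))%:E)%E.
  rewrite -(ge0_integral_independent (X1 := X1) (X2 := X2) _ mg g0).
    by apply: eq_integral => w _; rewrite /= gE.
  by move=> A C mA mC; exact: independent_off.
apply: ge0_le_integral => //.
- by move=> w _; apply: integral_ge0.
- exact: (measurable_fun_integral_pair P X1 X2 mg g0).
- apply/measurable_EFinP/measurable_mxtrace_mxexp.
    by move=> w; rewrite linearD /= sH sL.
  by apply: entry_measurableD => //; exact: entry_measurable_cst.
- move=> w _; under eq_integral do rewrite /= gE.
  exact: lieb_jensen.
Qed.

End independent_matrices.

(** * Replacing the summands one at a time *)

Section trace_mgf.
Context (disp : measure_display) (T : measurableType disp) (R : realType).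
Context (P : probability T R) (d n : nat) (X : 'I_n -> T -> 'M[R]_d).
Hypotheses (hX : forall k, random_symmx (X k)) (hind : independent_mx P X).

Lemma entry_measurable_off (k i : 'I_n) : i != k ->
  entry_measurable (X i : g_sigma_algebraType (cylinders_off X k) -> 'M[R]_d).
Proof.
move=> ik r s.
suff mXi : measurable_fun setT
    (X i : g_sigma_algebraType (cylinders_off X k) -> borel_mx R d).
  exact: (measurableT_comp (@measurable_borel_mx_entry R d r s) mXi).
move=> _ B mB; rewrite setTI; apply: sub_sigma_algebra.
exists (fun j => if j == i then B else setT); split.
- by move=> j; case: ifP.
- by rewrite eq_sym (negPf ik).
- apply/seteqP; split=> w /= => [Bw j _|/(_ i Logic.I)].
    by case: eqP => // ->.
  by rewrite /= eqxx.
Qed.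

Lemma mxtrace_mgf_sum theta :
  (forall k, integrable_mx P (fun w => mxexp (theta *: X k w))) ->
  (\int[P]_w (\tr (mxexp (theta *: \sum_k X k w)))%:E <=
   (\tr (mxexp (\sum_k
      mxlog (expectation_mx P (fun w => mxexp (theta *: X k w))))))%:E)%E.
Proof.
move=> iX.
pose L k := mxlog (expectation_mx P (fun w => mxexp (theta *: X k w))).
have sX k w : (theta *: X k w)^T = theta *: X k w.
  by rewrite linearZ /= (hX k).2.
have sL k : (L k)^T = L k.
  have mX : entry_measurable (fun w => theta *: X k w).
    exact/entry_measurableZ/entry_measurable_random_symmx.
  have [Q [v [oE _]]] := expectation_mxexp_posdef (sX k) mX (iX k).
  by rewrite /L /mxlog (mxfunE _ oE) !trmx_mul trmxK tr_diag_mx mulmxA.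
(* The first [m] summands have been replaced: [Y 0] is the random sum and [Y n] is constant. *)
pose Y m w := \sum_(k < n) (if (k < m)%N then L k else theta *: X k w).
suff IH m : (m <= n)%N ->
    (\int[P]_w (\tr (mxexp (Y 0 w)))%:E <=
     \int[P]_w (\tr (mxexp (Y m w)))%:E)%E.
  have -> : (\int[P]_w (\tr (mxexp (theta *: \sum_k X k w)))%:E =
      \int[P]_w (\tr (mxexp (Y 0 w)))%:E)%E.
    by apply: eq_integral => w _; rewrite /Y scaler_sumr.
  apply: le_trans (IH n (leqnn n)) _.
  under eq_integral.
    move=> w _; rewrite /Y.
    under eq_bigr do rewrite ltn_ord.
    over.
  by rewrite integral_cst// [X in (_ * X)%E](@probability_setT _ _ _ P) mule1.
elim: m => [//|m IH] mn; apply: le_trans (IH (ltnW mn)) _.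
pose k := Ordinal mn.
(* The part common to [Y m] and [Y m.+1]. Summand [k] is removed, which makes [H] measurable for the
   sigma-algebra of the others. *)
pose H w := \sum_(i < n) (if i == k then 0 else
  if (i < m)%N then L i else theta *: X i w).
have YH w : Y m w = H w + theta *: X k w.
  rewrite /Y /H (bigD1 k)//= ltnn [in RHS](bigD1 k)//= eqxx add0r addrC.
  by congr (_ + _); apply: eq_bigr => i /negPf ->.
have YH' w : Y m.+1 w = H w + L k.
  rewrite /Y /H (bigD1 k)//= ltnSn [in RHS](bigD1 k)//= eqxx add0r addrC.
  congr (_ + _); apply: eq_bigr => i ik; rewrite (negPf ik) ltnS leq_eqVlt.
  by have /negPf -> : (i : nat) != m by [].
under eq_integral do rewrite YH.
under [leRHS]eq_integral do rewrite YH'.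
apply: (integral_lieb_step hX hind) => //.
- move=> w; rewrite /H raddf_sum /=; apply: eq_bigr => i _.
  by case: ifP => _; [rewrite trmx0|case: ifP => _].
- apply: entry_measurable_sum => i; have [_|ik] := eqVneq i k.
    exact: entry_measurable_cst.
  case: (i < m)%N; first exact: entry_measurable_cst.
  apply: entry_measurableZ; exact: entry_measurable_off.
Qed.

End trace_mgf.

Theorem theorem2p9 (disp : measure_display) (T : measurableType disp)
    (R : realType) (P : probability T R) (d : nat) (hd : (0 < d)%N)
    (n : nat) (X : 'I_n -> T -> 'M[R]_d)
    (hX : forall k, random_symmx (X k)) (hind : independent_mx P X) (t : R) :
  (P [set w | (t <= lambda_min (\sum_(k < n) X k w))%R]
    <= (d%:R^-1)%:E *
       ereal_inf [set trace_bound P X t theta | theta in [set s | (0 < s)%R]])%E.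
Proof.
set A := [set w | _].
have d0 : 0 < d%:R :> R by rewrite ltr0n.
have sX w : (\sum_(k < n) X k w)^T = \sum_(k < n) X k w.
  by rewrite raddf_sum /=; apply: eq_bigr => k _; exact: (hX k).2.
have mX : entry_measurable (fun w => \sum_(k < n) X k w).
  by apply: entry_measurable_sum => k; exact: entry_measurable_random_symmx.
have mA : measurable A by exact: measurable_le_lambda_min.
(* Once [1 / d] is cancelled, it remains to bound [d P(A)] for each [theta] separately. *)
have -> : P A = ((d%:R^-1)%:E * (d%:R%:E * P A))%E.
  by rewrite muleA -EFinM mulVf ?mul1e// gt_eqF.
apply: lee_wpmul2l; first by rewrite lee_fin invr_ge0 ltW.
apply: le_ereal_inf_tmp => _ [theta /= theta0 <-].
rewrite /trace_bound; case: asboolP => [iX|_]; last exact: leey.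
rewrite EFinM.
apply: (@le_trans _ _ ((expR (- (theta * t)))%:E *
    \int[P]_w (\tr (mxexp (theta *: \sum_k X k w)))%:E)%E); last first.
  by apply: lee_wpmul2l; [rewrite lee_fin expR_ge0|exact: mxtrace_mgf_sum].
have sZ w : (theta *: \sum_(k < n) X k w)^T = theta *: \sum_(k < n) X k w.
  by rewrite linearZ /= sX.
have mZ := measurable_mxtrace_mxexp sZ (entry_measurableZ theta mX).
(* Markov's inequality, proved by comparing integrands: off [A] the left one is 0, and on [A] the
   bound is [le_lambda_min_mxexp]. *)
rewrite -[A]setIT -(integral_indic P measurableT mA).
have /measurable_EFinP mZE := mZ.
rewrite -ge0_integralZl_EFin//; last first.
  by apply/measurable_EFinP.
rewrite -ge0_integralZl_EFin//; last first.
  by move=> w _; rewrite lee_fin mxtrace_mxexp_ge0.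
apply: ge0_le_integral => //.
- by apply/measurable_EFinP; exact: measurable_funM.
- by apply/measurable_EFinP; exact: measurable_funM.
move=> w _; rewrite -!EFinM lee_fin indicE.
have [wA|_] := boolP (w \in A); last first.
  by rewrite mulr0 mulr_ge0 ?expR_ge0 ?mxtrace_mxexp_ge0.
rewrite mulr1 expRN mulrC ler_pdivlMr ?expR_gt0//.
by apply: le_lambda_min_mxexp => //; [exact: ltW|rewrite inE in wA].
Qed.
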